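(* Let $(L,Q,\mathcal{M}=Z+\mathcal{D})$ be a nonholonomic mechanical system with affine constraints, with constraint manifold $M\subset TQ$ and reaction-annihilator distribution $\mathcal{R}^\circ$, and let $Y$ be a vector field on $Q$. Any two of the following three conditions imply the third: (i) $Y-Z\in\Gamma(\mathcal{R}^\circ)$. (ii) $Y^{TQ}(L)=0$ in $M$. (iii) $E_{L,Y}|_M$ is a first integral of $(L,Q,\mathcal{M}=Z+\mathcal{D})$.
   Context: All objects are smooth and all vector fields are complete. $Q$ is an $n$-dimensional manifold. The Lagrangian $L:TQ\to\mathbb{R}$ has the form $L=T+b-V\circ\pi$, with $T$ the kinetic energy of a Riemannian metric on $Q$, $b$ a 1-form on $Q$ regarded as a function on $TQ$, $V$ a function on $Q$, and $\pi:TQ\to Q$ the projection. In bundle coordinates $(q,\dot q)$, $L(q,\dot q)=\frac12\dot q\cdot A(q)\dot q+b(q)\cdot\dot q-V(q)$ with $A$ symmetric and positive definite. $\mathcal{D}$ is a nonintegrable distribution on $Q$ of constant rank $r$, $1<r<n$, and $Z$ is a vector field on $Q$. The affine constraint distribution $\mathcal{M}=Z+\mathcal{D}$ has fibers $\mathcal{M}_q=Z(q)+\mathcal{D}_q\subset T_qQ$; the submanifold $M\subset TQ$ with fibers $\mathcal{M}_q$ is the constraint manifold. The constraint is ideal (d'Alembert): the equations of motion are the restriction to $M$ of $\frac{d}{dt}\frac{\partial L}{\partial\dot q}-\frac{\partial L}{\partial q}=R$, where $R:M\to\mathcal{D}^\circ$, $R(v_q)\in\mathcal{D}_q^\circ$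 (annihilator of $\mathcal{D}_q$), is the unique such function (the reaction force) for which these equations define a dynamics on $M$. In coordinates, if $\mathcal{D}_q=\ker S(q)$ with $S(q)$ a $k\times n$ matrix of rank $k=n-r$, and $s=-SZ$, then $R=S^T(SA^{-1}S^T)^{-1}(SA^{-1}\ell-\sigma)$ with $\ell_i=\sum_j\frac{\partial^2L}{\partial\dot q_i\partial q_j}\dot q_j-\frac{\partial L}{\partial q_i}$ and $\sigma_a=\sum_{i,j}\frac{\partial S_{ai}}{\partial q_j}\dot q_i\dot q_j+\sum_j\frac{\partial s_a}{\partial q_j}\dot q_j$. A first integral of $(L,Q,\mathcal{M})$ is a function on $M$ constant along all solutions of the equations of motion. The reaction-annihilator distribution $\mathcal{R}^\circ$ has fiber $\mathcal{R}^\circ_q$ equal to the annihilator in $T_qQ$ of $\mathcal{R}_q=\bigcup_{v_q\in\mathcal{M}_q}R(v_q)\subset\mathcal{D}_q^\circ$. Thus a vector field $W$ is in $\Gamma(\mathcal{R}^\circ)$ (i.e. is a section of $\mathcal{R}^\circ$) iff $\langle R(v_q),W(q)\rangle=0$ for all $q\in Q$, $v_q\in\mathcal{M}_q$. $p$ is the momentum 1-form generated by $L$ (in coordinates $p=\partial L/\partial\dot q$), $E_L:=\langle p,\cdot\rangle-L$ is the energy (in coordinates $E_L=p\cdot\dot q-L$), and $E_{L,Y}:=E_L-\langle p,Y\rangle$, a function on $TQ$. The tangent lift of $Y$ is the vector field on $TQ$ given by $Y^{TQ}=\sum_iY_i\partial_{q_i}+\sum_{i,j}\dot q_j\frac{\partial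 Y_i}{\partial q_j}\partial_{\dot q_i}$. *)

(* Defs.v *)
From HB Require Import structures.
From mathcomp Require Import all_boot all_order all_algebra.
From mathcomp Require Import all_classical all_reals all_analysis.
Set Implicit Arguments.
Unset Strict Implicit.
Unset Printing Implicit Defensive.
Import Order.TTheory GRing.Theory Num.Theory.
Import numFieldNormedType.Exports.
Local Open Scope classical_set_scope.
Local Open Scope ring_scope.

(* Coordinates of points and components of tangent vectors and covectors are
   columns 'cV[R]_n. *)

Section Calculus.
Context {R : realType} {V W : normedModType R}.

Fixpoint iter_derive (s : seq V) (f : V -> W) : V -> W :=
  if s is v :: s' then 'D_v (iter_derive s' f) else f.

(* C^oo on the open set O *)
Definition smooth_on (O : set V) (f : V -> W) : Prop :=
  forall (s : seq V) (x : V), O x -> differentiable (iter_derive s f) x.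

End Calculus.

Definition basis_col {R : realType} {n : nat} (a : 'I_n) : 'cV[R]_n :=
  delta_mx a 0.

Definition pairing {R : realType} {n : nat} (rho v : 'cV[R]_n) : R :=
  (rho^T *m v) 0 0.

(* A smooth n-manifold, given by a smooth atlas.  [param i] inverts [coord i]
   on the domain [dom i].  A chart [chart_at q] is selected around every point;
   it serves to represent tangent vectors, see below. *)
Structure smooth_manifold (R : realType) (n : nat) := SmoothManifold {
  mpoint :> topologicalType ;
  mhausdorff : hausdorff_space mpoint ;
  msecond_countable : @second_countable mpoint ;
  chart : Type ;
  dom : chart -> set mpoint ;
  coord : chart -> mpoint -> 'cV[R]_n ;
  param : chart -> 'cV[R]_n -> mpoint ;
  chart_at : mpoint -> chart ;
  mem_chart_at : forall q, dom (chart_at q) q ;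
  open_dom : forall i, open (dom i) ;
  open_codom : forall i, open (coord i @` dom i) ;
  coordK : forall i q, dom i q -> param i (coord i q) = q ;
  coord_continuous : forall i q, dom i q -> {for q, continuous (coord i)} ;
  param_continuous : forall i x, (coord i @` dom i) x ->
    {for x, continuous (param i)} ;
  transition_smooth : forall i j,
    smooth_on (coord i @` (dom i `&` dom j)) (coord j \o param i)
}.

Section Manifold.
Context {R : realType} {n : nat} (Q : smooth_manifold R n).
Implicit Types (q : Q) (i : chart Q).

(* A tangent vector at q is the column of its components in [chart_at q], and
   likewise for covectors.  So a vector field, or a 1-form, is a function
   Q -> 'cV[R]_n, and a function on TQ is a function Q -> 'cV[R]_n -> R.  The
   next two functions change the components of a tangent vector at q from
   [chart_at q] to the chart i and back. *)
Definition to_chart i q (v : 'cV[R]_n) : 'cV[R]_n :=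
  'D_v (coord i \o param (chart_at q)) (coord (chart_at q) q).

Definition of_chart i q (u : 'cV[R]_n) : 'cV[R]_n :=
  'D_u (coord (chart_at q) \o param i) (coord i q).

Definition codom i : set 'cV[R]_n := coord i @` dom i.

Definition field_in (Y : Q -> 'cV[R]_n) i (x : 'cV[R]_n) : 'cV[R]_n :=
  to_chart i (param i x) (Y (param i x)).

Definition fun_in (F : Q -> 'cV[R]_n -> R) i (x u : 'cV[R]_n) : R :=
  F (param i x) (of_chart i (param i x) u).

Definition velocity (gamma : R -> Q) (t : R) : 'cV[R]_n :=
  derive1 (coord (chart_at (gamma t)) \o gamma) t.

Definition smooth_curve (J : set R) (gamma : R -> Q) : Prop :=
  (forall t, J t -> {for t, continuous gamma}) /\
  (forall i, smooth_on (J `&` gamma @^-1` dom i) (coord i \o gamma)).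

Definition smooth_function (f : Q -> R) : Prop :=
  forall i, smooth_on (codom i) (f \o param i).

Definition smooth_one_form (b : Q -> 'cV[R]_n) : Prop :=
  forall i u,
    smooth_on (codom i) (fun x => fun_in (fun q => pairing (b q)) i x u).

Definition smooth_field (Y : Q -> 'cV[R]_n) : Prop :=
  forall i, smooth_on (codom i) (field_in Y i).

Definition complete_field (Y : Q -> 'cV[R]_n) : Prop :=
  forall q, exists gamma : R -> Q,
    [/\ smooth_curve setT gamma, gamma 0 = q &
        forall t, velocity gamma t = Y (gamma t)].

Definition bilin (g : 'M[R]_n) (v w : 'cV[R]_n) : R := (v^T *m g *m w) 0 0.

Definition riemannian_metric (g : Q -> 'M[R]_n) : Prop :=
  [/\ forall q, (g q)^T = g q,
      forall q v, v != 0 -> 0 < bilin (g q) v v &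
      forall i u w, smooth_on (codom i) (fun x =>
        bilin (g (param i x)) (of_chart i (param i x) u)
                              (of_chart i (param i x) w))].

(* L = T + b - V o pi *)
Record lagrangian := Lagrangian {
  metric : Q -> 'M[R]_n ;
  one_form : Q -> 'cV[R]_n ;
  potential : Q -> R ;
  metricP : riemannian_metric metric ;
  one_formP : smooth_one_form one_form ;
  potentialP : smooth_function potential
}.

Definition lagr (L : lagrangian) (q : Q) (v : 'cV[R]_n) : R :=
  2^-1 * bilin (metric L q) v v + pairing (one_form L q) v - potential L q.

(* [S] is a smooth matrix field of full rank on a neighbourhood of q, in the
   coordinates of the chart i, whose kernel is the distribution D there *)
Definition local_equation {r : nat} (D : Q -> set 'cV[R]_n) i q
    (S : 'cV[R]_n -> 'M[R]_(n - r, n)) : Prop :=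
  exists O : set 'cV[R]_n,
    [/\ open O, O (coord i q), O `<=` codom i & smooth_on O S] /\
    (forall x, O x -> \rank (S x) = (n - r)%N /\
       forall u, D (param i x) (of_chart i (param i x) u) <-> S x *m u = 0).

Definition smooth_distribution (r : nat) (D : Q -> set 'cV[R]_n) : Prop :=
  forall q, exists S : 'cV[R]_n -> 'M[R]_(n - r, n),
    local_equation D (chart_at q) q S.

(* D is tangent to a foliation: locally, it is the kernel of the differential of
   n - r functions (necessarily independent when D has rank r) *)
Definition integrable_distribution (r : nat) (D : Q -> set 'cV[R]_n) : Prop :=
  forall q, exists (O : set 'cV[R]_n) (F : 'cV[R]_n -> 'cV[R]_(n - r)),
    let i := chart_at q in
    [/\ open O, O (coord i q), O `<=` codom i & smooth_on O F] /\
    (forall x, O x ->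
       forall u, D (param i x) (of_chart i (param i x) u) <-> 'D_u F x = 0).

Definition affine_constraint (Z : Q -> 'cV[R]_n) (D : Q -> set 'cV[R]_n)
    (q : Q) : set 'cV[R]_n :=
  [set Z q + w | w in D q].

Section ReactionInCoordinates.
Variables (L : lagrangian) (Z : Q -> 'cV[R]_n) (i : chart Q).

Definition mass (x : 'cV[R]_n) : 'M[R]_n :=
  \matrix_(a, b) bilin (metric L (param i x))
                       (of_chart i (param i x) (basis_col a))
                       (of_chart i (param i x) (basis_col b)).

Definition ell (x u : 'cV[R]_n) : 'cV[R]_n :=
  let Li := fun_in (lagr L) i in
  \col_a (\sum_b 'D_(basis_col b) (fun y => 'D_(basis_col a) (Li y) u) x * u b 0
          - 'D_(basis_col a) (fun y => Li y u) x).

Definition sigma (k : nat) (S : 'cV[R]_n -> 'M[R]_(k, n)) (x u : 'cV[R]_n) :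
    'cV[R]_k :=
  let s y := - (S y *m field_in Z i y) in
  \col_a (\sum_b \sum_c
             'D_(basis_col c) (fun y => S y a b) x * u b 0 * u c 0
          + \sum_c 'D_(basis_col c) (fun y => s y a 0) x * u c 0).

Definition reaction_in (k : nat) (S : 'cV[R]_n -> 'M[R]_(k, n))
    (x u : 'cV[R]_n) : 'cV[R]_n :=
  let A := mass x in
  (S x)^T *m invmx (S x *m invmx A *m (S x)^T)
          *m (S x *m invmx A *m ell x u - sigma S x u).

End ReactionInCoordinates.

(* The covector does not depend on which local equation S of D is selected. *)
Definition reaction (L : lagrangian) (r : nat) (D : Q -> set 'cV[R]_n)
    (Z : Q -> 'cV[R]_n) (q : Q) (v : 'cV[R]_n) : 'cV[R]_n :=
  let i := chart_at q in
  let S : 'cV[R]_n -> 'M[R]_(n - r, n) :=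
    xget (fun=> 0) [set S | local_equation D i q S] in
  reaction_in L Z i S (coord i q) v.

Definition reaction_set L r D Z (q : Q) : set 'cV[R]_n :=
  [set reaction L r D Z q v | v in affine_constraint Z D q].

Definition reaction_annihilator L r D Z (q : Q) : set 'cV[R]_n :=
  [set w | forall rho, reaction_set L r D Z q rho -> pairing rho w = 0].

(* d/dt (dL/dqdot) - dL/dq along gamma at time t, in the chart i *)
Definition euler_lagrange (L : lagrangian) i (gamma : R -> Q) (t : R) :
    'cV[R]_n :=
  let Li := fun_in (lagr L) i in
  let c := coord i \o gamma in
  \col_a (derive1 (fun t' => 'D_(basis_col a) (Li (c t')) (derive1 c t')) t
          - 'D_(basis_col a) (fun y => Li y (derive1 c t)) (c t)).

Definition solution (L : lagrangian) (r : nat) (D : Q -> set 'cV[R]_n)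
    (Z : Q -> 'cV[R]_n) (J : set R) (gamma : R -> Q) : Prop :=
  [/\ open J, is_interval J, smooth_curve J gamma &
      forall t, J t ->
        affine_constraint Z D (gamma t) (velocity gamma t) /\
        euler_lagrange L (chart_at (gamma t)) gamma t
          = reaction L r D Z (gamma t) (velocity gamma t)].

Definition complete_dynamics L r D Z : Prop :=
  forall q v, affine_constraint Z D q v ->
    exists gamma : R -> Q,
      [/\ solution L r D Z setT gamma, gamma 0 = q & velocity gamma 0 = v].

Definition first_integral L r D Z (F : Q -> 'cV[R]_n -> R) : Prop :=
  forall (J : set R) (gamma : R -> Q), solution L r D Z J gamma ->
    forall t t', J t -> J t' ->
      F (gamma t) (velocity gamma t) = F (gamma t') (velocity gamma t').

(* p is the fibre derivative of F : TQ -> R *)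
Definition momentum (F : Q -> 'cV[R]_n -> R) (q : Q) (v : 'cV[R]_n) :
    'cV[R]_n :=
  \col_a 'D_(basis_col a) (F q) v.

Definition energy (F : Q -> 'cV[R]_n -> R) (q : Q) (v : 'cV[R]_n) : R :=
  pairing (momentum F q v) v - F q v.

Definition moving_energy (F : Q -> 'cV[R]_n -> R) (Y : Q -> 'cV[R]_n)
    (q : Q) (v : 'cV[R]_n) : R :=
  energy F q v - pairing (momentum F q v) (Y q).

(* Y^{TQ}(F) at (q, v) *)
Definition tangent_lift (Y : Q -> 'cV[R]_n) (F : Q -> 'cV[R]_n -> R)
    (q : Q) (v : 'cV[R]_n) : R :=
  let i := chart_at q in
  let x := coord i q in
  let Fi := fun_in F i in
  let Yi := field_in Y i in
  \sum_a Yi x a 0 * 'D_(basis_col a) (fun y => Fi y v) x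
  + \sum_a \sum_b v b 0 * 'D_(basis_col b) (fun y => Yi y a 0) x
                        * 'D_(basis_col a) (Fi x) v.

End Manifold.

(* Main.v *)
Require Import Defs.
From HB Require Import structures.
From mathcomp Require Import all_boot all_order all_algebra.
From mathcomp Require Import all_classical all_reals all_analysis.
From mathcomp Require Import ring.
Import Order.TTheory GRing.Theory Num.Theory.
Import numFieldNormedType.Exports.
(* The manifold operations coord and codom take precedence over their homonyms
   for bases of vector spaces and for finite functions. *)
Import Defs.
Local Open Scope classical_set_scope.
Local Open Scope ring_scope.

(** The proposition is a corollary of one identity.  Along every smooth curve
    gamma in Q, with v = gamma' and EL the left-hand side of the Lagrange
    equations,

      d/dt E_{L,Y}(gamma, v) = <EL, v - Y> - Y^{TQ}(L)(gamma, v)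

    ([moving_energy_balance]).  In coordinates E_{L,Y} = p . (v - Y) - L, where
    p is the momentum; the terms p . v' coming from the first factor and from L
    cancel, and what remains is (p' - dL/dq) . (v - Y) minus the two sums
    that make up the tangent lift ([energy_balance_chart]).

    On a solution, EL is the reaction force R(v), and v - Y = w - (Y - Z) with w
    in D.  As R(v) annihilates D ([pairing_reaction]), the identity becomes

      d/dt E_{L,Y}(gamma, v) = - (<R(v), Y - Z> + Y^{TQ}(L)(gamma, v))

    ([moving_energy_solution]).  If both terms on the right vanish on M, the
    moving energy is constant along solutions.  Conversely a solution starts at
    every point of M, so that, when the moving energy is a first integral, the
    sum of the two terms vanishes at every point of M, and each of them vanishes
    with the other.

    The identity is proved at each time t in the single chart selected at
    gamma t, while E_{L,Y}(gamma s, gamma' s) is expressed, for each s, in the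
    chart selected at gamma s.  Comparing the two takes the invariance of the
    moving energy under changes of charts ([moving_energy_in]). *)

Set Implicit Arguments.
Unset Strict Implicit.

(** * Directional derivatives *)

Section Calculus.
Context {R : realType}.

(** Computes the fibre derivatives of a Lagrangian, which is a polynomial of
    degree two in the velocities. *)
Lemma is_derive_quadratic (V : normedModType R) (f : V -> R) (v w : V) (a b : R) :
  (forall h, f (h *: w + v) = f v + h * a + h ^+ 2 * b) -> is_derive v w f a.
Proof.
move=> fE.
have quotE : (fun h : R => h^-1 *: (f (h *: w + v) - f v)) @ 0^' --> a.
  have lim0 : (fun h : R => a + h * b) @ 0^' --> a.
    rewrite -[X in _ --> X]addr0 -[X in _ --> a + X](mul0r b).
    apply: cvgD; first exact: cvg_cst.
    by apply: cvgM; [exact: nbhs_dnbhs | exact: cvg_cst].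
  apply: cvg_trans lim0; apply: near_eq_cvg.
  near=> h.
  have h0 : h != 0 by near: h; exact: nbhs_dnbhs_neq.
  by rewrite fE /GRing.scale /=; field.
by apply: DeriveDef; [apply/cvg_ex; exists a | exact/cvg_lim].
Unshelve. all: by end_near. Qed.

(** This rule and the next three are the pointwise forms of the rules for sums and
    products in the ring of functions; coordinate expressions have this form. *)
Lemma is_derive_fsum (V : normedModType R) (n : nat) (x v : V)
    (f : 'I_n -> V -> R) (df : 'I_n -> R) :
  (forall i, is_derive x v (f i) (df i)) ->
  is_derive x v (fun y => \sum_(i < n) f i y) (\sum_(i < n) df i).
Proof.
move=> fP; have -> : (fun y => \sum_(i < n) f i y) = \sum_(i < n) f i.
  by apply/funext => y; rewrite fct_sumE.
exact: is_derive_sum.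
Qed.

Lemma is_derive_mul (V : normedModType R) (x v : V) (f g : V -> R) (df dg : R) :
  is_derive x v f df -> is_derive x v g dg ->
  is_derive x v (fun y => f y * g y) (f x * dg + df * g x).
Proof.
move=> fP gP; rewrite [X in is_derive _ _ X](_ : _ = f * g)//.
apply: is_derive_eq; by rewrite /GRing.scale /= [df * _]mulrC.
Qed.

Lemma is_derive_sub (V : normedModType R) (x v : V) (f g : V -> R) (df dg : R) :
  is_derive x v f df -> is_derive x v g dg ->
  is_derive x v (fun y => f y - g y) (df - dg).
Proof. by move=> fP gP; exact: is_deriveB. Qed.

Lemma is_derive_add (V : normedModType R) (x v : V) (f g : V -> R) (df dg : R) :
  is_derive x v f df -> is_derive x v g dg ->
  is_derive x v (fun y => f y + g y) (df + dg).
Proof. by move=> fP gP; exact: is_deriveD. Qed.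

Lemma col_basis_sum n (v : 'cV[R]_n) :
  v = \sum_(a < n) v a 0 *: basis_col a.
Proof.
apply/matrixP => i j; rewrite summxE (bigD1 i)//= big1 => [|k ki].
  by rewrite !mxE eqxx (ord1 j) addr0 mulr1.
by rewrite !mxE eq_sym (negbTE ki) mulr0.
Qed.

Lemma derive_basis n (f : 'cV[R]_n -> R) (x v : 'cV[R]_n) :
  differentiable f x ->
  'D_v f x = \sum_(a < n) v a 0 * 'D_(basis_col a) f x.
Proof.
move=> df; rewrite deriveE// [in LHS](col_basis_sum v).
have dZ (k : R) (w : 'cV[R]_n) : 'd f x (k *: w) = k *: 'd f x w.
  by rewrite linearZ.
rewrite linear_sum /=.
by apply: eq_bigr => a _; rewrite deriveE// dZ.
Qed.

Lemma derive1_comp_diff (V W : normedModType R) (c : R -> V) (f : V -> W)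
    (t : R) :
  differentiable c t -> differentiable f (c t) ->
  (f \o c)^`()%classic t = 'D_(c^`()%classic t) f (c t).
Proof.
move=> dc df; rewrite derive1E'; last exact: differentiable_comp.
rewrite derive1E'// deriveE//.
by rewrite (diff_comp dc df).
Qed.

Lemma is_derive_comp (V : normedModType R) (c : R -> V) (f : V -> R) (t : R) :
  differentiable c t -> differentiable f (c t) ->
  is_derive t 1 (fun s => f (c s)) ('D_(c^`()%classic t) f (c t)).
Proof.
move=> dc df; rewrite -derive1_comp_diff// derive1E.
by apply: derivableP; apply/derivable1_diffP; exact: differentiable_comp.
Qed.

Lemma differentiable_entry (V : normedModType R) m n (f : V -> 'M[R]_(m, n))
    (x : V) i j :
  differentiable f x -> differentiable (fun y => f y i j) x.
Proof.
move=> df.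
exact: (differentiable_comp df (differentiable_coord (f x) i j)).
Qed.

Lemma is_derive_entry n (c : R -> 'cV[R]_n) (t : R) (a : 'I_n) :
  differentiable c t ->
  is_derive t 1 (fun s => c s a 0) (c^`()%classic t a 0).
Proof.
move=> dc; have dca := differentiable_entry a 0 dc.
have -> : c^`()%classic t a 0 = 'D_1 (fun s => c s a 0) t.
  by rewrite derive1E derive_mx ?mxE //; exact/derivable1_diffP.
by apply: derivableP; exact/derivable1_diffP.
Qed.

End Calculus.

(** * The energy balance in an open subset of a coordinate space *)

Section CoordinateLagrangian.
Context {R : realType} {n : nat}.
Local Notation E := 'cV[R]_n.

Lemma scalar_scale (f : E -> R) (k : R) (v : E) :
  scalar f -> f (k *: v) = k * f v.
Proof.
move=> f_lin; have f0 : f 0 = 0.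
  by have := f_lin (-1) 0 0; rewrite scaler0 add0r mulN1r addNr.
by have := f_lin k v 0; rewrite addr0 f0 addr0.
Qed.

Lemma scalar_basis_sum (f : E -> R) (v : E) :
  scalar f -> f v = \sum_(a < n) v a 0 * f (basis_col a).
Proof.
move=> f_lin; have f0 : f 0 = 0.
  by rewrite -(scale0r 0) scalar_scale// mul0r.
rewrite [in LHS](col_basis_sum v).
elim/big_rec2: _ => [//|a s w _ <-]; exact: f_lin.
Qed.

(** The forms G x and B x are required to be linear only over U: outside the
    image of a chart, the coefficients read in that chart are arbitrary. *)
Context (U : set E) (G : E -> E -> E -> R) (B : E -> E -> R) (V : E -> R).
Context (G_sym : forall x v w, U x -> G x v w = G x w v).
Context (G_lin : forall x v, U x -> scalar (G x v)).
Context (B_lin : forall x, U x -> scalar (B x)).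
Context (G_diff : forall x v w, U x -> differentiable (fun y => G y v w) x).
Context (B_diff : forall x v, U x -> differentiable (fun y => B y v) x).
Context (V_diff : forall x, U x -> differentiable V x).

Definition mechanical (x v : E) : R := 2^-1 * G x v v + B x v - V x.

Definition fibre_derivative (x v w : E) : R := G x v w + B x w.

(** Taylor's formula in the velocities, exact because the Lagrangian has degree
    two in them.  It gives the momentum and, along a curve, the derivative
    of the Lagrangian with the dependence on the base point separated from
    the dependence on the velocity. *)
Lemma mechanical_expansion x v w : U x ->
  mechanical x (w + v) = mechanical x v + fibre_derivative x v w + 2^-1 * G x w w.
Proof.
move=> Ux; have GD u y z : G x u (y + z) = G x u y + G x u z.
  by have := G_lin u Ux 1 y z; rewrite scale1r mul1r.
have BD y z : B x (y + z) = B x y + B x z.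
  by have := B_lin Ux 1 y z; rewrite scale1r mul1r.
rewrite /mechanical /fibre_derivative BD GD !(G_sym (w + v))// !GD.
by rewrite (G_sym w v)//; field.
Qed.

Lemma is_derive_mechanical x v w : U x ->
  is_derive v w (mechanical x) (fibre_derivative x v w).
Proof.
move=> Ux; apply: (@is_derive_quadratic _ _ _ _ _ _ (2^-1 * G x w w)) => h.
have GZ u y k : G x u (k *: y) = k * G x u y.
  by apply: scalar_scale; exact: G_lin.
have BZ y k : B x (k *: y) = k * B x y.
  by apply: scalar_scale; exact: B_lin.
rewrite mechanical_expansion// /fibre_derivative !GZ BZ (G_sym (h *: w))// GZ.
ring.
Qed.

Lemma fibre_derivative_lin x v : U x -> scalar (fibre_derivative x v).
Proof.
by move=> Ux k u w; rewrite /fibre_derivative G_lin// B_lin//; ring.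
Qed.

Lemma fibre_derivative_sum x v w : U x ->
  fibre_derivative x v w
    = \sum_(a < n) w a 0 * 'D_(basis_col a) (mechanical x) v.
Proof.
move=> Ux; rewrite (scalar_basis_sum _ (fibre_derivative_lin v Ux)).
apply: eq_bigr => a _; congr (_ * _).
by have H := is_derive_mechanical v (basis_col a) Ux; rewrite derive_val.
Qed.

Lemma differentiable_mechanical x v : U x ->
  differentiable (fun y => mechanical y v) x.
Proof.
move=> Ux; apply: differentiableB; last exact: V_diff.
apply: differentiableD; last exact: B_diff.
by apply: differentiableM => //; exact: G_diff.
Qed.

(** Let p be the fibre derivative at the velocity u.  The derivative of
    p . (u - y) is p' . (u - y) + p . u' - p . (Dy u), and the derivative of the
    Lagrangian is dL/dx . u + p . u'; the terms p . u' cancel, and dL/dx . u is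
    split as dL/dx . (u - y) + dL/dx . y. *)
Lemma energy_balance_chart (c : R -> E) (y : E -> E) (t : R) :
  (\forall s \near t, U (c s)) ->
  differentiable c t -> differentiable (c^`()%classic : R -> E) t ->
  differentiable y (c t) ->
  let u := c^`()%classic : R -> E in
  is_derive t 1
    (fun s => fibre_derivative (c s) (u s) (u s - y (c s))
              - mechanical (c s) (u s))
    (\sum_(a < n)
        ((fun s => 'D_(basis_col a) (mechanical (c s)) (u s))^`()%classic t
         - 'D_(basis_col a) (fun x => mechanical x (u t)) (c t))
        * (u t a 0 - y (c t) a 0)
     - (\sum_(a < n) y (c t) a 0
          * 'D_(basis_col a) (fun x => mechanical x (u t)) (c t)
        + \sum_(a < n) \sum_(b < n)
            u t b 0 * 'D_(basis_col b) (fun x => y x a 0) (c t)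
            * 'D_(basis_col a) (mechanical (c t)) (u t))).
Proof.
move=> Uc dc du dy u.
have Uct : U (c t) := nbhs_singleton Uc.
pose P a s := 'D_(basis_col a) (mechanical (c s)) (u s).
(* In terms of G and B, the components of the momentum along the curve are
   visibly differentiable in time. *)
have PE a : \forall s \near t,
    P a s = \sum_(b < n) u s b 0 * G (c s) (basis_col a) (basis_col b)
            + B (c s) (basis_col a).
  near=> s; have Us : U (c s) by near: s.
  have H := is_derive_mechanical (u s) (basis_col a) Us.
  rewrite /P derive_val /fibre_derivative G_sym//.
  by rewrite (scalar_basis_sum (u s) (G_lin _ Us)).
have c_comp (f : E -> R) : differentiable f (c t) ->
    is_derive t 1 (fun s => f (c s)) ('D_(u t) f (c t)).
  by move=> df; exact: (is_derive_comp dc df).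
have u_entry a := is_derive_entry a du.
have dP a : is_derive t 1 (P a) ((P a)^`()%classic t).
  rewrite derive1E; apply: derivableP.
  have PE' : {near t, (fun s => \sum_(b < n) u s b 0
      * G (c s) (basis_col a) (basis_col b) + B (c s) (basis_col a)) =1 P a}.
    by apply: filterS (PE a) => s ->.
  apply: (near_eq_derivable PE').
  have dG b := is_derive_mul (u_entry b)
                 (c_comp _ (G_diff (basis_col a) (basis_col b) Uct)).
  by case: (is_derive_add (is_derive_fsum dG) (c_comp _ (B_diff (basis_col a) Uct))).
(* The Lagrangian at time s is expanded around the velocity at time t.  The
   increment w vanishes at t, so the quadratic term contributes nothing to the
   derivative and the linear one contributes p . u'. *)
pose w s a := u s a 0 - u t a 0.
have eE : {near t, (fun s => \sum_(a < n) (u s a 0 - y (c s) a 0) * P a s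
    - (mechanical (c s) (u t)
       + \sum_(a < n) w s a * fibre_derivative (c s) (u t) (basis_col a)
       + 2^-1 * \sum_(a < n) w s a *
           \sum_(b < n) w s b * G (c s) (basis_col a) (basis_col b)))
   =1 (fun s => fibre_derivative (c s) (u s) (u s - y (c s))
              - mechanical (c s) (u s))}.
  near=> s; have Us : U (c s) by near: s.
  rewrite fibre_derivative_sum//; congr (_ - _).
    by apply: eq_bigr => a _; rewrite !mxE.
  rewrite -[in RHS](subrK (u t) (u s)) mechanical_expansion//.
  congr (_ + _ + _ * _).
    rewrite (scalar_basis_sum _ (fibre_derivative_lin _ Us)).
    by apply: eq_bigr => a _; rewrite !mxE.
  rewrite (scalar_basis_sum _ (G_lin _ Us)).
  apply: eq_bigr => a _; rewrite !mxE G_sym//; congr (_ * _).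
  rewrite (scalar_basis_sum _ (G_lin _ Us)).
  by apply: eq_bigr => b _; rewrite !mxE.
apply: (near_eq_is_derive eE).
have dw a : is_derive t 1 (w^~ a) (u^`()%classic t a 0).
  rewrite -[X in is_derive _ _ _ X]subr0.
  exact: (is_derive_sub (u_entry a) (is_derive_cst (u t a 0) t 1)).
have dy_entry a : differentiable (fun x => y x a 0) (c t).
  exact: differentiable_entry.
have dG a b := is_derive_mul (dw b)
                 (c_comp _ (G_diff (basis_col a) (basis_col b) Uct)).
have dquad := is_derive_mul (is_derive_cst (2^-1 : R) t 1)
                (is_derive_fsum (fun a => is_derive_mul (dw a)
                                            (is_derive_fsum (dG a)))).
have dmom a := is_derive_add (c_comp _ (G_diff (u t) (basis_col a) Uct))
                             (c_comp _ (B_diff (basis_col a) Uct)).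
have dlin := is_derive_fsum (fun a => is_derive_mul (dw a) (dmom a)).
have dbase := c_comp _ (differentiable_mechanical (u t) Uct).
have dpair := is_derive_fsum (fun a =>
  is_derive_mul (is_derive_sub (u_entry a) (c_comp _ (dy_entry a))) (dP a)).
have dtotal := is_derive_sub dpair
                 (is_derive_add (is_derive_add dbase dlin) dquad).
apply: (@is_derive_eq _ _ _ _ _ _ _ _ dtotal).
have w0 a : w t a = 0 by rewrite /w subrr.
rewrite [X in 2^-1 * X]big1 => [|a _]; last first.
  by rewrite w0 mul0r add0r [X in _ * X]big1 ?mulr0// => b _; rewrite w0 mul0r.
rewrite mulr0 mul0r !addr0 (derive_basis _ (differentiable_mechanical _ Uct)).
rewrite -!big_split/= -!sumrB; apply: eq_bigr => a _.
rewrite w0 mul0r add0r (derive_basis _ (dy_entry a)).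
have -> : G (c t) (u t) (basis_col a) + B (c t) (basis_col a) = P a t.
  by have H := is_derive_mechanical (u t) (basis_col a) Uct; rewrite /P derive_val.
rewrite -mulr_suml -/(P a t) -/(P a).
ring.
Unshelve. all: by end_near. Qed.

End CoordinateLagrangian.

(** * Changes of charts *)

Section Charts.
Context {R : realType} {n : nat} {Q : smooth_manifold R n}.
Implicit Types (q : Q) (i j : chart Q) (x u v : 'cV[R]_n).

Lemma dom_param i x : codom i x -> dom i (param i x).
Proof. by case=> q qi <-; rewrite coordK. Qed.

Lemma paramK i x : codom i x -> coord i (param i x) = x.
Proof. by case=> q qi <-; rewrite coordK. Qed.

Lemma codom_coord i q : dom i q -> codom i (coord i q).
Proof. by move=> qi; exists q. Qed.

Lemma near_open (T : topologicalType) (A : set T) (p : T) :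
  open A -> A p -> \forall p' \near p, A p'.
Proof. by move=> oA Ap; apply: open_nbhs_nbhs. Qed.

Lemma near_codom i x : codom i x -> \forall y \near x, codom i y.
Proof. by move=> xi; apply: near_open; [exact: open_codom |]. Qed.

Lemma near_overlap i j q : dom i q -> dom j q ->
  \forall x \near coord i q, codom i x /\ dom j (param i x).
Proof.
move=> qi qj; have xi := codom_coord qi; near=> x; split.
  by near: x; exact: near_codom.
near: x; apply: (param_continuous xi); rewrite coordK//.
exact: near_open (open_dom j) qj.
Unshelve. all: by end_near. Qed.

Lemma transition_differentiable i j q : dom i q -> dom j q ->
  differentiable (coord j \o param i) (coord i q).
Proof.
by move=> qi qj; apply: (transition_smooth (i := i) (j := j) [::]); exists q.
Qed.

Lemma of_chart_lin i q k u v : dom i q ->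
  of_chart i q (k *: u + v) = k *: of_chart i q u + of_chart i q v.
Proof.
move=> qi; have df := transition_differentiable qi (mem_chart_at q).
by rewrite /of_chart !deriveE// linearP.
Qed.

Lemma of_chartB i q u v : dom i q ->
  of_chart i q (u - v) = of_chart i q u - of_chart i q v.
Proof.
by move=> qi; rewrite addrC -scaleN1r of_chart_lin// scaleN1r addrC.
Qed.

Lemma derive_near_id (f : 'cV[R]_n -> 'cV[R]_n) x v :
  (\forall y \near x, f y = y) -> 'D_v f x = v.
Proof.
by move=> fE; rewrite (near_eq_derive v (g := id)) ?derive_id.
Qed.

(** The chain rule: the two transition maps are inverse to each other not only at
    the point but on a neighbourhood of its coordinates. *)
Lemma to_chartK i q v : dom i q -> of_chart i q (to_chart i q v) = v.
Proof.
move=> qi; have qj := mem_chart_at q.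
have dij := transition_differentiable qi qj.
have dji := transition_differentiable qj qi.
set j := chart_at q in qj dij dji.
rewrite /of_chart /to_chart -/j (deriveE _ dji) (deriveE _ dij).
have xE : (coord i \o param j) (coord j q) = coord i q by rewrite /= coordK.
rewrite -xE in dij *.
have := diff_comp dji dij => /(congr1 (fun f => f v)) /= <-.
rewrite -deriveE; last exact: differentiable_comp.
apply: derive_near_id; near=> y.
have [yj yi] : codom j y /\ dom i (param j y) by near: y; exact: near_overlap.
by rewrite /= coordK// paramK.
Unshelve. all: by end_near. Qed.

Lemma of_chart_at q u : of_chart (chart_at q) q u = u.
Proof.
apply: derive_near_id; near=> y; apply: paramK; near: y.
by apply: near_codom; apply: codom_coord; exact: mem_chart_at.
Unshelve. all: by end_near. Qed.

(** Makes it possible to follow a curve over a time interval in one fixed chart,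
    although [velocity] uses a chart that changes with time. *)
Lemma velocity_of_chart i (gamma : R -> Q) t :
  dom i (gamma t) -> {for t, continuous gamma} ->
  differentiable (coord i \o gamma) t ->
  velocity gamma t
    = of_chart i (gamma t) ((coord i \o gamma)^`()%classic t).
Proof.
move=> qi gc dc; rewrite /velocity /of_chart.
have df := transition_differentiable qi (mem_chart_at (gamma t)).
rewrite -[coord i (gamma t)]/((coord i \o gamma) t) -derive1_comp_diff//.
rewrite !derive1E; apply: near_eq_derive; near=> s.
rewrite /= coordK//; near: s; apply: gc.
exact: near_open (open_dom i) qi.
Unshelve. all: by end_near. Qed.

Lemma field_in_of_chart (Y : Q -> 'cV[R]_n) i q : dom i q ->
  of_chart i q (field_in Y i (coord i q)) = Y q.
Proof. by move=> qi; rewrite /field_in coordK// to_chartK. Qed.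

End Charts.

(** * The energy balance on the manifold *)

Section Balance.
Context {R : realType} {n : nat} {Q : smooth_manifold R n}.
Context (L : lagrangian Q).
Implicit Types (q : Q) (i : chart Q) (x u v w : 'cV[R]_n).

Lemma bilin_sym (g : 'M[R]_n) v w : g^T = g -> bilin g v w = bilin g w v.
Proof.
move=> gT; rewrite /bilin.
have -> : w^T *m g *m v = (v^T *m g *m w)^T.
  by rewrite !trmx_mul trmxK gT mulmxA.
by rewrite [in RHS]mxE.
Qed.

Lemma bilin_lin (g : 'M[R]_n) v : scalar (bilin g v).
Proof. by move=> k u w; rewrite /bilin mulmxDr -scalemxAr !mxE. Qed.

Lemma pairing_lin (b : 'cV[R]_n) : scalar (pairing b).
Proof. by move=> k u w; rewrite /pairing mulmxDr -scalemxAr !mxE. Qed.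

Lemma pairingE (b v : 'cV[R]_n) : pairing b v = \sum_(a < n) b a 0 * v a 0.
Proof. by rewrite /pairing mxE; apply: eq_bigr => a _; rewrite mxE. Qed.

Definition metric_in i x u w : R :=
  bilin (metric L (param i x)) (of_chart i (param i x) u)
                               (of_chart i (param i x) w).

Local Notation form_in i := (fun_in (fun q => pairing (one_form L q)) i).

Local Notation lagr_in i := (mechanical (metric_in i) (form_in i)
                                        (potential L \o param i)).

Lemma metric_in_sym i x u w : codom i x -> metric_in i x u w = metric_in i x w u.
Proof. by move=> _; have [gT _ _] := metricP L; exact: bilin_sym. Qed.

Lemma metric_in_lin i x u : codom i x -> scalar (metric_in i x u).
Proof.
move=> xi k v w; rewrite /metric_in of_chart_lin; last exact: dom_param.
exact: bilin_lin.
Qed.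

Lemma form_in_lin i x : codom i x -> scalar (form_in i x).
Proof.
move=> xi k v w; rewrite /fun_in of_chart_lin; last exact: dom_param.
exact: pairing_lin.
Qed.

Lemma metric_in_diff i x u w : codom i x ->
  differentiable (fun y => metric_in i y u w) x.
Proof. by move=> xi; have [_ _ /(_ i u w [::] x xi)] := metricP L. Qed.

Lemma form_in_diff i x u : codom i x ->
  differentiable (fun y => form_in i y u) x.
Proof. by move=> xi; have := one_formP L (i := i) u [::] xi. Qed.

Lemma potential_in_diff i x : codom i x ->
  differentiable (potential L \o param i) x.
Proof. by move=> xi; have := potentialP L (i := i) [::] xi. Qed.

Lemma lagr_inE i : fun_in (lagr L) i = lagr_in i.
Proof. by []. Qed.

(** An expression in which the fibre coordinates no longer appear: every term is
    intrinsic, and hence can be transported to any chart.  The fibre derivative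
    is computed in the chart selected at q, where components do not change. *)
Lemma moving_energy_lagr (Y : Q -> 'cV[R]_n) q v :
  moving_energy (lagr L) Y q v
    = bilin (metric L q) v (v - Y q) + pairing (one_form L q) (v - Y q)
      - lagr L q v.
Proof.
have qj := mem_chart_at q; set j := chart_at q in qj.
have xj : codom j (coord j q) := codom_coord qj.
have lagrE : lagr L q = lagr_in j (coord j q).
  by apply/funext => u; rewrite -lagr_inE /fun_in coordK// of_chart_at.
have pE w : pairing (momentum (lagr L) q v) w
    = bilin (metric L q) v w + pairing (one_form L q) w.
  have := fibre_derivative_sum (potential L \o param j) (@metric_in_sym j)
            (@metric_in_lin j) (@form_in_lin j) v w xj.
  rewrite {1}/fibre_derivative {1}/metric_in {1}/fun_in coordK// !of_chart_at => ->.
  by rewrite pairingE; apply: eq_bigr => a _; rewrite mxE lagrE mulrC.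
rewrite /moving_energy /energy !pE.
have BL := pairing_lin (one_form L q) (-1) (Y q) v.
have GL := bilin_lin (metric L q) v (-1) (Y q) v.
have -> : v - Y q = -1 *: Y q + v by rewrite scaleN1r addrC.
by rewrite BL GL; ring.
Qed.

(** Invariance under changes of charts: [of_chart] is linear and carries the
    components of u and of Y in the chart i to those used by the intrinsic
    expression. *)
Lemma moving_energy_in (Y : Q -> 'cV[R]_n) i q u : dom i q ->
  moving_energy (lagr L) Y q (of_chart i q u)
    = fibre_derivative (metric_in i) (form_in i) (coord i q) u
        (u - field_in Y i (coord i q))
      - lagr_in i (coord i q) u.
Proof.
move=> qi; rewrite moving_energy_lagr -{1 2}(field_in_of_chart Y qi).
rewrite -of_chartB// /fibre_derivative /metric_in /mechanical /fun_in /=.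
by rewrite /metric_in coordK.
Qed.

(** Near t, the curve stays in the chart selected at gamma t, where the statement
    is [energy_balance_chart]. *)
Lemma moving_energy_balance (Y : Q -> 'cV[R]_n) (J : set R) (gamma : R -> Q) t :
  smooth_field Y -> open J -> smooth_curve J gamma -> J t ->
  is_derive t 1
    (fun s => moving_energy (lagr L) Y (gamma s) (velocity gamma s))
    (pairing (euler_lagrange L (chart_at (gamma t)) gamma t)
             (velocity gamma t - Y (gamma t))
     - tangent_lift Y (lagr L) (gamma t) (velocity gamma t)).
Proof.
move=> Y_smooth openJ [gamma_cont gamma_smooth] Jt.
have qi := mem_chart_at (gamma t); set i := chart_at (gamma t) in qi *.
have near_i : \forall s \near t, J s /\ dom i (gamma s).
  near=> s; split; near: s; first exact: near_open openJ Jt.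
  by apply: (gamma_cont _ Jt); exact: near_open (open_dom i) qi.
pose c := coord i \o gamma.
have dc s : J s -> dom i (gamma s) -> differentiable c s.
  by move=> Js si; apply: (gamma_smooth i [::]).
have du : differentiable (c^`()%classic : R -> 'cV[R]_n) t.
  have -> : c^`()%classic = 'D_1 c by apply/funext => s; rewrite derive1E.
  exact: (gamma_smooth i [:: 1] t (conj Jt qi)).
have ci : codom i (c t) := codom_coord qi.
have dy : differentiable (field_in Y i) (c t) := Y_smooth i [::] _ ci.
have near_c : \forall s \near t, codom i (c s).
  by apply: filterS near_i => s [_ /codom_coord].
have vE s : J s -> dom i (gamma s) ->
    velocity gamma s = of_chart i (gamma s) (c^`()%classic s).
  by move=> Js si; apply: velocity_of_chart => //; [exact: gamma_cont|exact: dc].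
have vt : velocity gamma t = c^`()%classic t by rewrite vE// of_chart_at.
have Yt : field_in Y i (c t) = Y (gamma t).
  by rewrite -[RHS](field_in_of_chart Y qi) of_chart_at.
have balance := energy_balance_chart (@metric_in_sym i) (@metric_in_lin i)
  (@form_in_lin i) (@metric_in_diff i) (@form_in_diff i) (@potential_in_diff i)
  near_c (dc _ Jt qi) du dy.
have eE : \forall s \near t,
    fibre_derivative (metric_in i) (form_in i) (c s) (c^`()%classic s)
      (c^`()%classic s - field_in Y i (c s)) - lagr_in i (c s) (c^`()%classic s)
    = moving_energy (lagr L) Y (gamma s) (velocity gamma s).
  near=> s; have [Js si] : J s /\ dom i (gamma s) by near: s.
  by rewrite /= vE// moving_energy_in.
apply: (near_eq_is_derive eE).
apply: (@is_derive_eq _ _ _ _ _ _ _ _ balance).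
rewrite pairingE /tangent_lift -/i vt; congr (_ - _).
by apply: eq_bigr => a _; rewrite !mxE -Yt.
Unshelve. all: by end_near. Qed.

(** D'Alembert's principle: the reaction force is in the image of the transpose
    of S, whose annihilator is the kernel of S. *)
Lemma pairing_reaction (r : nat) (D : Q -> set 'cV[R]_n) (Z : Q -> 'cV[R]_n)
    q v w :
  smooth_distribution r D -> D q w -> pairing (reaction L r D Z q v) w = 0.
Proof.
move=> /(_ q) /(xgetPex (fun=> 0)); rewrite /reaction.
set S := xget _ _; move=> [U [[_ Uq _ _] SP]] Dqw.
have [_ /(_ w)] := SP _ Uq.
rewrite coordK ?of_chart_at; last exact: mem_chart_at.
move=> /iffLR /(_ Dqw) Sw0.
by rewrite /pairing /reaction_in /= !trmx_mul trmxK -!mulmxA Sw0 !mulmx0 mxE.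
Qed.

(** The velocity v is Z + w with w in D, and the reaction force does not work on
    w: only its work on Z - Y remains. *)
Lemma moving_energy_solution (r : nat) (D : Q -> set 'cV[R]_n)
    (Z Y : Q -> 'cV[R]_n) (J : set R) (gamma : R -> Q) t :
  smooth_distribution r D -> smooth_field Y ->
  solution L r D Z J gamma -> J t ->
  let q := gamma t in let v := velocity gamma t in
  is_derive t 1
    (fun s => moving_energy (lagr L) Y (gamma s) (velocity gamma s))
    (- (pairing (reaction L r D Z q v) (Y q - Z q)
        + tangent_lift Y (lagr L) q v)).
Proof.
move=> D_distr Y_smooth [openJ _ gammaP eqs] Jt q v.
have balance := moving_energy_balance Y_smooth openJ gammaP Jt.
apply: (@is_derive_eq _ _ _ _ _ _ _ _ balance).
have [[w Dqw vE] ->] := eqs t Jt; rewrite -/q -/v [RHS]opprD; congr (_ - _).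
have -> : v - Y q = (-1) *: (Y q - Z q) + w.
  by rewrite /v -vE scaleN1r opprB [RHS]addrAC.
by rewrite pairing_lin (pairing_reaction _ _ D_distr Dqw) mulN1r addr0.
Qed.

Lemma first_integral_derive (r : nat) (D : Q -> set 'cV[R]_n)
    (Z : Q -> 'cV[R]_n) (F : Q -> 'cV[R]_n -> R) :
  (forall J gamma, solution L r D Z J gamma -> forall t, J t ->
     is_derive t 1 (fun s => F (gamma s) (velocity gamma s)) 0) ->
  first_integral L r D Z F.
Proof.
move=> dF J gamma sol; set f := fun s => F (gamma s) (velocity gamma s).
have intJ : is_interval J by case: sol.
have mono a b : J a -> J b -> a <= b -> f a = f b.
  move=> Ja Jb ab.
  have Jab s : a <= s <= b -> J s by exact: intJ.
  have [||s _] := @MVT_segment R f (fun=> 0) a b ab.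
  - by move=> s; rewrite in_itv/= => /andP[/ltW as_ /ltW sb];
      apply: (dF _ _ sol); apply: Jab; rewrite as_.
  - apply: derivable_within_continuous => s; rewrite in_itv/= => /Jab Js.
    by have [] := dF _ _ sol s Js.
  by rewrite mul0r => /eqP; rewrite subr_eq0 => /eqP.
move=> t t' Jt Jt'; case: (leP t t') => [tt'|/ltW t't].
  exact: (mono t t').
by rewrite -[LHS]/(f t) -(mono t' t).
Qed.

End Balance.

(** * The moving energy as a first integral *)

Unset Implicit Arguments.
Set Strict Implicit.

Theorem proposition4 (R : realType) (n r : nat) (Q : smooth_manifold R n)
    (L : lagrangian Q) (D : Q -> set 'cV[R]_n) (Z Y : Q -> 'cV[R]_n)
    (r_gt1 : (1 < r)%N) (r_ltn : (r < n)%N)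
    (D_distr : smooth_distribution r D)
    (D_nonint : ~ integrable_distribution r D)
    (Z_smooth : smooth_field Z) (Z_complete : complete_field Z)
    (Y_smooth : smooth_field Y) (Y_complete : complete_field Y)
    (LDZ_complete : complete_dynamics L r D Z) :
  let cond_i := forall q : Q, reaction_annihilator L r D Z q (Y q - Z q) in
  let cond_ii := forall (q : Q) (v : 'cV[R]_n), affine_constraint Z D q v ->
    tangent_lift Y (lagr L) q v = 0 in
  let cond_iii := first_integral L r D Z (moving_energy (lagr L) Y) in
  [/\ cond_i -> cond_ii -> cond_iii, cond_i -> cond_iii -> cond_ii & cond_ii -> cond_iii -> cond_i].
Proof.
move=> cond_i cond_ii cond_iii.
(* The moving energy is constant along the solution starting at v. *)
have balance0 q v : cond_iii -> affine_constraint Z D q v ->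
    pairing (reaction L r D Z q v) (Y q - Z q) + tangent_lift Y (lagr L) q v = 0.
  move=> iii /LDZ_complete[gamma [sol g0 v0]].
  have dE := moving_energy_solution D_distr Y_smooth sol (t := 0) I.
  have Ecst : (fun s => moving_energy (lagr L) Y (gamma s) (velocity gamma s))
      = cst (moving_energy (lagr L) Y (gamma 0) (velocity gamma 0)).
    by apply/funext => s; exact: (iii setT).
  have : 'D_1 (fun s => moving_energy (lagr L) Y (gamma s) (velocity gamma s))
      (0 : R) = 0 by rewrite Ecst derive_cst.
  by rewrite derive_val g0 v0 => /eqP; rewrite oppr_eq0 => /eqP.
split=> [i ii|i iii q v Mv|ii iii q _ [v Mv <-]].
- apply: first_integral_derive => J gamma sol t Jt.
  have dE := moving_energy_solution D_distr Y_smooth sol Jt.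
  apply: (@is_derive_eq _ _ _ _ _ _ _ _ dE).
  have Mv : affine_constraint Z D (gamma t) (velocity gamma t).
    by case: sol => _ _ _ /(_ t Jt)[].
  by rewrite ii// addr0 i ?oppr0//; exists (velocity gamma t).
- have := balance0 q v iii Mv.
  by rewrite i ?add0r//; exists v.
- by have := balance0 q v iii Mv; rewrite ii// addr0.
Qed.
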